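(* Let $\kappa<\mathsf{add}(m^0)$ be a non-zero cardinal, let $Z$ be a separable metrizable space, and let $X_\alpha$ be subspaces of $Z$ with the Miller property for $\alpha\in\kappa$. Then $\bigcap_{\alpha\in\kappa}X_\alpha$ has the Miller property.
   Context: A space is crowded if it is non-empty and has no isolated points. A space $X$ has the Miller property if for every countable crowded $Q\subseteq X$ there exists a crowded $Q'\subseteq Q$ whose closure in $X$ is compact. A set $Y\subseteq\omega^\omega$ is Miller-null if for every closed subset $N$ of $\omega^\omega$ homeomorphic to $\omega^\omega$ there is a closed $N'\subseteq N$ homeomorphic to $\omega^\omega$ with $N'\cap Y=\varnothing$. $m^0$ is the ideal of Miller-null subsets of $\omega^\omega$, and $\mathsf{add}(m^0)$ is the least cardinality of a family $\mathcal{X}\subseteq m^0$ with $\bigcup\mathcal{X}\notin m^0$. *)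

(* Defs.v *)
From HB Require Import structures.
From mathcomp Require Import all_boot all_order all_algebra.
From mathcomp Require Import all_classical all_reals all_analysis.

Set Implicit Arguments.
Unset Strict Implicit.
Unset Printing Implicit Defensive.

Import Order.TTheory GRing.Theory Num.Theory.

Local Open Scope classical_set_scope.
Local Open Scope ring_scope.
Local Open Scope card_scope.

(* The topology of [X] is the one induced by some [R]-valued metric;
   nonnegativity of [d] follows from the three listed axioms. *)
Definition metrizable (R : realType) (X : topologicalType) : Prop :=
  exists d : X -> X -> R,
    [/\ forall x y, d x y = 0 <-> x = y,
        forall x y, d x y = d y x,
        forall x y z, d x z <= d x y + d y z &
        forall (x : X) (A : set X),
          nbhs x A <-> exists2 e : R, 0 < e & [set y | d x y < e] `<=` A].

Definition separable (X : topologicalType) : Prop :=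
  exists2 D : set X, countable D & dense D.

Definition homeomorphic (X Y : topologicalType) : Prop :=
  exists (f : X -> Y) (g : Y -> X),
    [/\ continuous f, continuous g, cancel f g & cancel g f].

(* [isolated A] is relative to [A], so this says that the subspace [A] is
   crowded. *)
Definition crowded (X : topologicalType) (A : set X) : Prop :=
  A !=set0 /\ isolated A = set0.

(* A property of spaces: for [A : set Z], [miller_property (set_type A)] uses
   the subspace topology of [A], and [closure] is then the closure in [A]. *)
Definition miller_property (X : topologicalType) : Prop :=
  forall Q : set X, countable Q -> crowded Q ->
    exists Q' : set X, [/\ Q' `<=` Q, crowded Q' & compact (closure Q')].

Definition baire_space : Type := prod_topology (fun _ : nat => nat).

HB.instance Definition _ := Pointed.on baire_space.
HB.instance Definition _ := Nbhs.on baire_space.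
HB.instance Definition _ := Topological.on baire_space.

Definition miller_null (Y : set baire_space) : Prop :=
  forall N : set baire_space,
    closed N -> homeomorphic (set_type N) baire_space ->
    exists N' : set baire_space,
      [/\ N' `<=` N, closed N', homeomorphic (set_type N') baire_space &
          N' `&` Y = set0].

Definition m0 : set (set baire_space) := [set Y | miller_null Y].

(* Cardinals are represented by sets, compared through [#<=]: the cardinality
   of [F] is add(I), the least cardinality of a subfamily of [I] whose union is
   not in [I]. *)
Definition is_add (T : Type) (I F : set (set T)) : Prop :=
  [/\ F `<=` I,
      ~ I (\bigcup_(Y in F) Y) &
      forall G : set (set T),
        G `<=` I -> ~ I (\bigcup_(Y in G) Y) -> F #<= G].

Definition card_lt (T U : Type) (A : set T) (B : set U) : Prop :=
  A #<= B /\ ~ (B #<= A).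

(* Main.v *)
(* Fix a countable crowded [Q] in the intersection. Since the index set is
   non-empty, one of the [X a] already provides a crowded [Q0] included in [Q]
   whose closure is compact. A scheme of shrinking balls centered in [Q0],
   those at the children of a node converging to the center at that node,
   embeds the Baire space in [closure Q0] by a map [e] that avoids [Q] and
   whose remainder [closure (range e) `\` range e] is included in [Q].
   Whenever [f] embeds the Baire space as a closed subset of itself, the
   remainder of [e \o f] is a crowded subset of [Q], because the Baire space is
   nowhere locally compact. The Miller property of [X a], applied to these
   remainders, shows that [e @^-1` (~` X a)] is Miller-null. So the union of
   these sets over [a] is Miller-null and misses a closed copy of the Baire
   space; the remainder of the image of this copy is the required set. *)
Require Import Defs.
From mathcomp Require Import all_boot all_order all_algebra.
From mathcomp Require Import all_classical all_reals all_analysis.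
From mathcomp Require Import lra.

Import Order.TTheory GRing.Theory Num.Theory.

Local Open Scope classical_set_scope.

(** * Crowded sets, embeddings and the Miller property of subspaces *)

Lemma crowdedP (T : topologicalType) (A : set T) :
  crowded A <-> A !=set0 /\
    forall x V, A x -> nbhs x V -> exists y, [/\ A y, V y & y <> x].
Proof.
split=> -[A0 cA]; split=> //.
  move=> x V Ax Vx; apply: contrapT => /forallNP noy.
  suff : isolated A x by rewrite cA.
  split; first exact: mem_set.
  exists V => //; apply/seteqP; split=> [y [Vy Ay]|y ->].
    by apply: contrapT => yx; apply: (noy y).
  by split=> //; exact: nbhs_singleton.
apply/seteqP; split=> // x [/set_mem Ax [V Vx VA]].
have [y [Ay Vy yx]] := cA x V Ax Vx.
by apply: yx; have : (V `&` A) y by []; rewrite VA.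
Qed.

(** Phrased with neighborhoods, so that a homeomorphism onto the range needs no subspace type for
    the range. *)
Definition embedding {T Z : topologicalType} (f : T -> Z) : Prop :=
  injective f /\
  forall x A, nbhs x A <-> exists2 B, nbhs (f x) B & f @^-1` B `<=` A.

Lemma embedding_continuous {T Z : topologicalType} (f : T -> Z) :
  embedding f -> continuous f.
Proof. by move=> [_ fE] x B Bfx; apply/fE; exists B. Qed.

Lemma embedding_comp {T U Z : topologicalType} (f : T -> U) (g : U -> Z) :
  embedding f -> embedding g -> embedding (g \o f).
Proof.
move=> [finj fE] [ginj gE]; split=> [x y /ginj /finj //|x A].
rewrite fE; split=> [[B /gE [C Cx CB] BA]|[C Cx CA]].
  by exists C => // y /CB /BA.
by exists (g @^-1` C) => //; apply/gE; exists C.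
Qed.

Lemma embedding_cancel {T U Z : topologicalType} (f : T -> U) (g : U -> Z) :
  embedding g -> embedding (g \o f) -> embedding f.
Proof.
move=> [ginj gE] [gfinj gfE]; split=> [x y fxy|x A].
  by apply: gfinj => /=; rewrite fxy.
rewrite gfE; split=> [[C Cx CA]|[B /gE [C Cx CB] BA]].
  by exists (g @^-1` C) => //; apply/gE; exists C.
by exists C => // y /= /CB /BA.
Qed.

Lemma embedding_lift {T U Z : topologicalType} (f : T -> Z) (g : U -> Z) :
  embedding f -> embedding g -> range f `<=` range g ->
  exists2 h : T -> U, embedding h & forall x, g (h x) = f x.
Proof.
move=> femb gemb fg.
have /choice [h hE] : forall x, exists y, g y = f x.
  by move=> x; have [|y _ <-] := fg (f x); [exists x|exists y].
exists h => //; apply: (embedding_cancel h g gemb).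
by rewrite (_ : g \o h = f) //; apply/funext.
Qed.

Lemma embedding_set_val {Z : topologicalType} (A : set Z) :
  embedding (set_val : set_type A -> Z).
Proof.
split=> [x y|x U]; first by rewrite set_valE; exact: val_inj.
split=> [[_ [[V oV <-] Vx VU]]|[B]].
  by exists V => //; exact: open_nbhs_nbhs.
by move=> /(@initial_continuous (set_type A) Z set_val x) Bx /filterS; apply.
Qed.

Lemma homeomorphic_embedding {T U : topologicalType} (f : T -> U) (g : U -> T) :
  continuous f -> continuous g -> cancel f g -> embedding f.
Proof.
move=> cf cg fK; split=> [|x A]; first exact: can_inj fK.
split=> [Ax|[B Bfx BA]]; last by apply: filterS BA _; exact: cf.
exists (g @^-1` A); last by move=> y /=; rewrite fK.
by apply: cg; rewrite fK.
Qed.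

(** From here on, copies of the Baire space are handled as ranges of embeddings, which compose. *)
Lemma homeomorphic_rangeP {T Z : topologicalType} (N : set Z) :
  homeomorphic (set_type N) T <->
  exists2 f : T -> Z, embedding f & range f = N.
Proof.
split=> [[f [g [cf cg fK gK]]]|[f femb fN]].
  exists (set_val \o g).
    apply: embedding_comp (embedding_set_val N).
    exact: homeomorphic_embedding cg cf gK.
  apply/seteqP; split=> [_ [x _ <-]|z Nz]; first exact: set_valP.
  by exists (f (SigSub (mem_set Nz))) => //=; rewrite fK.
have [h hemb hE] : exists2 h : T -> set_type N, embedding h &
    forall x, set_val (h x) = f x.
  apply: embedding_lift => //; first exact: embedding_set_val.
  move=> z; rewrite fN => Nz; by exists (SigSub (mem_set Nz)).
have /choice [g gE] : forall y : set_type N, exists x, f x = set_val y.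
  move=> y; have [|x _ fx] := (_ : N `<=` range f) (set_val y) (set_valP y).
    by rewrite fN.
  by exists x.
have gK : cancel g h.
  by move=> y; apply: (embedding_set_val N).1; rewrite hE gE.
have hK : cancel h g by move=> x; apply: femb.1; rewrite gE hE.
exists g, h; split=> //; last exact: embedding_continuous.
move=> y A /hemb.2 [B]; rewrite gK => By BA.
by apply: filterS By => z Bz; apply: BA; rewrite /preimage /= gK.
Qed.

Lemma embedding_preimage_closure {T Z : topologicalType} (f : T -> Z)
    (Q : set T) :
  embedding f -> f @^-1` (closure (f @` Q)) = closure Q.
Proof.
move=> [finj fE]; apply/seteqP; split=> x clx A.
  move=> /fE [B Bx BA]; have [_ [[y Qy <-] By]] := clx B Bx.
  by exists y; split=> //; exact: BA.
move=> Afx; have [|y [Qy Ay]] := clx (f @^-1` A); first by apply/fE; exists A.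
by exists (f y); split => //; exists y.
Qed.

Lemma crowded_image {T Z : topologicalType} (f : T -> Z) (Q : set T) :
  embedding f -> crowded (f @` Q) <-> crowded Q.
Proof.
move=> [finj fE]; rewrite !crowdedP; split=> -[Q0 cQ]; split.
- by have [_ [x Qx _]] := Q0; exists x.
- move=> x V Qx /fE [B Bx BV].
  have [||_ [[y Qy <-] By yx]] := cQ (f x) B; [by exists x|by []|].
  by exists y; split=> //; [exact: BV|move=> yx'; apply: yx; rewrite yx'].
- by have [x Qx] := Q0; exists (f x); exists x.
- move=> _ V [x Qx <-] Vx.
  have [//||y [Qy Vy yx]] := cQ x (f @^-1` V); first by apply/fE; exists V.
  by exists (f y); split; [exists y|exact: Vy|move/finj].
Qed.

(** A compact closure taken in [A] has a compact, hence closed, image in the Hausdorff space [Z], so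
    this image contains the closure taken in [Z]. *)
Lemma miller_property_subspaceP (Z : topologicalType) (A : set Z) :
  hausdorff_space Z ->
  miller_property (set_type A) <->
  forall Q : set Z, Q `<=` A -> countable Q -> crowded Q ->
    exists Q', [/\ Q' `<=` Q, crowded Q', compact (closure Q') &
                   closure Q' `<=` A].
Proof.
move=> hZ; have vemb := embedding_set_val A.
have im_pre (Q : set Z) : Q `<=` A ->
    (set_val : set_type A -> Z) @` (set_val @^-1` Q) = Q.
  move=> QA; apply/seteqP; split=> [_ [x Qx <-] //|z Qz].
  by exists (SigSub (mem_set (QA _ Qz))).
split=> [mA Q QA cQ crQ|mA Q cQ crQ].
  have [||Q' [Q'Q crQ' coQ']] := mA (set_val @^-1` Q).
  - apply: card_le_trans cQ; apply: card_ge_preimage => x y _ _.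
    exact: vemb.1.
  - by apply/(crowded_image _ _ vemb); rewrite im_pre.
  - have clK : set_val @` closure Q' `<=` A.
      by move=> _ [x _ <-]; exact: set_valP.
    have coK : compact (set_val @` closure Q').
      apply: continuous_compact => //.
      by apply: continuous_subspaceT; exact: embedding_continuous.
    have subK : closure (set_val @` Q') `<=` set_val @` closure Q'.
      rewrite [X in _ `<=` X](closure_id _).1; last exact: compact_closed.
      by apply/closureS/image_subset/subset_closure.
    exists (set_val @` Q'); split.
    + by move=> _ [x /Q'Q Qx <-].
    + exact/(crowded_image _ _ vemb).
    + by apply: subclosed_compact coK _ => //; exact: closed_closure.
    + exact: subset_trans subK clK.
have [|||Q' [Q'Q crQ' coQ' clQ']] := mA (set_val @` Q).
- by move=> _ [x _ <-]; exact: set_valP.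
- exact: card_le_trans (card_image_le _ _) cQ.
- exact/(crowded_image _ _ vemb).
have Q'A : Q' `<=` A by apply: subset_trans clQ'; exact: subset_closure.
exists (set_val @^-1` Q'); split.
- by move=> x /Q'Q [y Qy /vemb.1 <-].
- by apply/(crowded_image _ _ vemb); rewrite im_pre.
move=> F FF Fcl.
have clE : set_val @^-1` closure Q' =
    closure (set_val @^-1` Q' : set (set_type A)).
  by rewrite -(embedding_preimage_closure _ _ vemb) im_pre.
(* The filter is pushed to [Z]; its cluster point there lies in [closure Q'], hence in [A], and is
   pulled back. *)
have [|z [clz cluz]] := coQ' (set_val @ F) _; first by rewrite -clE in Fcl.
have Az := clQ' _ clz.
exists (SigSub (mem_set Az)); split; first by rewrite -clE.
move=> M B FM /vemb.2 [C Cz CB].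
have [||_ [[x Mx <-] Cx]] := cluz (set_val @` M) C; [|exact: Cz|].
  by apply: (@filterS _ F _ M) => // x Mx; exists x.
by exists x; split=> //; exact: CB.
Qed.

(** * Neighborhoods and remainders of copies of the Baire space *)

Definition cylinder (x : baire_space) (n : nat) : set baire_space :=
  [set y | forall i, (i < n)%N -> y i = x i].

Lemma nbhs_baireP (x : baire_space) (A : set baire_space) :
  nbhs x A <-> exists n, cylinder x n `<=` A.
Proof.
split=> [Ax|[n /filterS]]; last first.
  apply; rewrite (_ : cylinder x n =
    [set y | forall i : 'I_n, (proj i @^-1` [set x i]) y]); last first.
    apply/seteqP; split=> y xy i; first exact: xy.
    by move=> ltin; exact: (xy (Ordinal ltin)).
  apply: (@filter_forall _ _ (fun i : 'I_n => proj (i : nat) @^-1` [set x i])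
    (nbhs x) (nbhs_filter x)) => i.
  by apply: (@proj_continuous nat (fun=> nat) i x); exact: discrete_set1.
pose F := filter_from [set: nat] (cylinder x).
have FF : Filter F.
  apply: filter_from_filter; first by exists 0%N.
  move=> i j _ _; exists (maxn i j) => // y xy.
  by split=> k ltk; apply: xy; rewrite leq_max ltk ?orbT.
suff /(_ A Ax) [n _] : F --> x by exists n.
(* Convergence is checked coordinatewise; coordinate [i] is constant on the cylinder of length
   [i.+1]. *)
apply/cvg_sup => i U [V [[W oW <-] Wx WU]].
by exists i.+1 => // y xy; apply: WU; rewrite /= xy.
Qed.

(** Each neighborhood of a point of the range contains the image of a sequence without cluster point
    in the Baire space. By compactness the image has a cluster point, necessarily in the
    remainder. *)
Lemma crowded_remainder (Z : topologicalType) (f : baire_space -> Z) :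
  hausdorff_space Z -> regular_space Z ->
  embedding f -> compact (closure (range f)) ->
  crowded (closure (range f) `\` range f).
Proof.
move=> hZ rZ femb cof.
have key x U : nbhs (f x) U -> ((closure (range f) `\` range f) `&` U) !=set0.
  move=> /rZ [W Wfx WU].
  have /nbhs_baireP [n nW] : nbhs x (f @^-1` W) by exact: embedding_continuous.
  (* All [y k] stay in the cylinder of length [n], but their coordinates at [n] tend to infinity. *)
  pose y k : baire_space := fun i => if i == n then k else x i.
  have Wy k : W (f (y k)).
    by apply: nW => i ltin; rewrite /y ltn_eqF.
  have ev (A : set Z) : (forall k, A (f (y k))) -> ((f \o y) @ \oo) A.
    by move=> Ay; exact: (@filterE _ \oo _ _ Ay).
  have [|z [clz cluz]] := cof ((f \o y) @ \oo) (fmap_proper_filter _ _).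
    apply: (ev (closure (range f))) => k.
    by apply: (@subset_closure _ (range f)); exists (y k).
  suff zR : ~ range f z.
    exists z; split; first by [].
    by apply: WU => V Vz; apply: cluz Vz; apply: ev => k; exact: Wy.
  (* Near [w] the coordinate at [n] equals [w n], while [y k] has coordinate [k > w n] for all large
     [k]. *)
  move=> [w _ fwz].
  have /femb.2 [B] : nbhs w (cylinder w n.+1).
    by apply/nbhs_baireP; exists n.+1.
  rewrite fwz => Bz BC.
  have [||_ [[k /= ltk <-]]] :=
    cluz [set f (y k) | k in [set k | (w n < k)%N]] B; [|exact: Bz|].
    by exists (w n).+1 => // k /= ltk; exists k.
  move=> /BC /(_ n (ltnSn n)).
  by rewrite /y eqxx => kw; rewrite kw ltnn in ltk.
apply/crowdedP; split.
  have [z [zR _]] := key (fun=> 0%N) setT filterT.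
  by exists z.
move=> z U [clz fz] Uz.
(* A point [f x] of the range close to [z] is used to find another point of the remainder in [U]
   without [z]. *)
have [_ [[x _ <-] Ufx]] := clz (interior U) (nbhs_interior Uz).
have zfx : z <> f x by move=> zfx; apply: fz; exists x.
have Vfx : nbhs (f x) (U `\ z).
  apply: filterI; first exact: Ufx.
  apply: open_nbhs_nbhs; split; last by move=> /esym.
  by apply: closed_openC; exact/accessible_closed_set1/hausdorff_accessible.
have [w [wR [Uw wz]]] := key x _ Vfx.
by exists w.
Qed.

(** * Elementary facts on a metric inducing the topology *)

Section metric_facts.
Context {R : realType} {Z : topologicalType} {d : Z -> Z -> R}.
Hypothesis d0 : forall x y, d x y = 0%R <-> x = y.
Hypothesis dC : forall x y, d x y = d y x.
Hypothesis dD : forall x y z, (d x z <= d x y + d y z)%R.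
Hypothesis dnbhs : forall (x : Z) (A : set Z),
  nbhs x A <-> exists2 e : R, (0 < e)%R & [set y | (d x y < e)%R] `<=` A.

Local Open Scope ring_scope.

Lemma dist_self x : d x x = 0. Proof. exact/d0. Qed.

Lemma dist_ge0 x y : 0 <= d x y.
Proof. by have := dD x y x; rewrite dist_self (dC y x); lra. Qed.

Lemma dist_gt0 {x y} : x <> y -> 0 < d x y.
Proof.
by move=> xy; rewrite lt_neqAle dist_ge0 andbT eq_sym; apply/eqP => /d0.
Qed.

Lemma dist_nbhs x (e : R) : 0 < e -> nbhs x [set y | d x y < e].
Proof. by move=> e0; apply/dnbhs; exists e. Qed.

Lemma nbhs_open_ball p x (e : R) : d p x < e -> nbhs x [set y | d p y < e].
Proof.
move=> pxe; apply/dnbhs; exists (e - d p x); first by rewrite subr_gt0.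
by move=> y /= xy; have := dD p x y; lra.
Qed.

Lemma closed_ball_closed p (e : R) : closed [set y | d p y <= e].
Proof.
move=> z clz /=; rewrite leNgt; apply/negP => ez.
have [|y [/= py zy]] := clz [set y | d z y < d p z - e].
  by apply: dist_nbhs; rewrite subr_gt0.
by have := dD p y z; rewrite (dC y z); lra.
Qed.

Lemma dist_hausdorff : hausdorff_space Z.
Proof.
move=> x y cl; apply: contrapT => xy; have xy0 := dist_gt0 xy.
have e0 : 0 < d x y / 2 by lra.
have [z [/= xz yz]] := cl _ _ (dist_nbhs x _ e0) (dist_nbhs y _ e0).
by have := dD x z y; rewrite (dC z y); lra.
Qed.

Lemma dist_regular : regular_space Z.
Proof.
move=> x A /dnbhs [e e0 eA].
have e20 : 0 < e / 2 by lra.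
exists [set y | d x y < e / 2]; first exact: dist_nbhs.
apply: subset_trans eA; apply: (@subset_trans _ [set y | d x y <= e / 2]).
  move=> z clz; apply: (@closed_ball_closed x (e / 2)) => V Vz.
  by have [w [/= /ltW xw Vw]] := clz V Vz; exists w.
by move=> y /=; lra.
Qed.

Lemma dist_le_inv_eq (x y : Z) :
  (forall n, d x y <= 2 * n.+1%:R^-1) -> x = y.
Proof.
move=> xy; apply: contrapT => /dist_gt0 xy0.
have [|n] := @ltr_add_invr R 0 (d x y / 2); first by lra.
by have := xy n; move: (n.+1%:R^-1) => u; lra.
Qed.

(** * Sequences of disjoint balls converging to a point of a crowded set *)

Section fan.
Variable P : set Z.
Hypothesis crP : crowded P.

(** One ball of the fan. The last component of [g del] bounds from below the distance of the ball to
    [p]; it serves as an outer radius for the next ball. *)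
Lemma fan_step (p r : Z) (eta : R) : P p -> 0 < eta ->
  exists g : R -> Z * R * R, forall del, 0 < del ->
    [/\ P (g del).1.1, 0 < (g del).1.2, (g del).1.2 <= eta, 0 < (g del).2 &
      forall y, d (g del).1.1 y <= (g del).1.2 ->
        [/\ y <> r, (g del).2 <= d p y & d p y < del]].
Proof.
move=> Pp eta0.
suff /choice [g gP] : forall del, exists t : Z * R * R, 0 < del ->
    [/\ P t.1.1, 0 < t.1.2, t.1.2 <= eta, 0 < t.2 &
      forall y, d t.1.1 y <= t.1.2 ->
        [/\ y <> r, t.2 <= d p y & d p y < del]].
  by exists g.
move=> del; have [del0|] := ltP 0 del; last first.
  by exists (p, 0, 0).
have [_ crPP] := (crowdedP _ P).1 crP.
have [p1 [Pp1 pp1 p1p]] := crPP p _ Pp (dist_nbhs p _ del0).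
have p1p0 : 0 < d p p1 by apply: dist_gt0 => /esym.
(* If the first candidate [p1] is [r], a point of [P] closer to [p] will do. *)
have [q [Pq pq qp qr]] : exists q, [/\ P q, d p q < del, 0 < d p q & q <> r].
  have [p1r|] := pselect (p1 = r); last by exists p1.
  have [q [Pq pq qp]] := crPP p _ Pp (dist_nbhs p _ p1p0).
  exists q; split=> //; first exact: lt_trans pp1.
    by apply: dist_gt0 => /esym.
  by move=> qr; move: pq; rewrite /= qr -p1r ltxx.
have qr0 := dist_gt0 qr.
(* The four bounds respect [eta], exclude [r], keep the ball at distance at least [d p q / 2] from
   [p], and keep it within [del] of [p]. *)
pose m := Num.min (Num.min eta (d q r / 2))
                  (Num.min (d p q / 2) ((del - d p q) / 2)).
have m0 : 0 < m by rewrite !lt_min; apply/andP; split; apply/andP; split; lra.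
have : m <= m by []; rewrite {2}/m !le_min => /andP[/andP[m1 m2] /andP[m3 m4]].
exists (q, m, d p q / 2) => _; split=> //=; first by lra.
move=> y qy; split.
- by move=> yr; rewrite yr in qy; lra.
- by have := dD p y q; rewrite (dC y q); lra.
- by have := dD p q y; lra.
Qed.

(* The balls of radius [(c n).2] around [(c n).1] sit in disjoint annuli
   centered at [p] and converge to [p]. *)
Lemma fan (p r : Z) (eps eta : R) : P p -> 0 < eps -> 0 < eta ->
  exists c : nat -> Z * R,
    (forall n, [/\ P (c n).1, 0 < (c n).2, (c n).2 <= eta &
      forall y, d (c n).1 y <= (c n).2 ->
        [/\ y <> r, d p y < eps & d p y < n.+1%:R^-1]]) /\
    forall m n y, d (c m).1 y <= (c m).2 -> d (c n).1 y <= (c n).2 -> m = n.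
Proof.
move=> Pp eps0 eta0; have [g gP] := fan_step p r eta Pp eta0.
(* [del n] is the outer radius of annulus [n]: at most the inner radius of the preceding annulus, or
   [eps] at the start. *)
pose fix del n : R := Num.min (n.+1%:R^-1)
  (if n is n'.+1 then (g (del n')).2 else eps).
have delS n : del n.+1 <= (g (del n)).2 by rewrite /= ge_min lexx orbT.
have del_inv n : del n <= n.+1%:R^-1 by case: n => *; rewrite /= ge_min lexx.
have del0 n : 0 < del n.
  elim: n => [|n IH] /=; rewrite lt_min invr_gt0 ltr0Sn //=.
  by have [] := gP _ IH.
have gdel n : (g (del n)).2 < del n.
  have [_ r0 _ _ /(_ (g (del n)).1.1)] := gP _ (del0 n).
  by rewrite dist_self ltW // => /(_ isT) [_ le1 lt1]; exact: le_lt_trans lt1.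
have delW m n : (m <= n)%N -> del n <= del m.
  elim: n => [|n IH]; first by rewrite leqn0 => /eqP ->.
  rewrite leq_eqVlt => /predU1P[->//|/IH]; apply: le_trans.
  exact: le_trans (delS n) (ltW (gdel n)).
have del_eps n : del n <= eps.
  by apply: le_trans (delW 0 n isT) _; rewrite /= ge_min lexx orbT.
exists (fun n => (g (del n)).1); split=> [n|].
  have [Pq q0 qeta _ ball] := gP _ (del0 n); split=> // y /ball [yr _ py].
  by split=> //; apply: lt_le_trans py _.
have disj m n y : (m < n)%N -> d (g (del m)).1.1 y <= (g (del m)).1.2 ->
    d (g (del n)).1.1 y <= (g (del n)).1.2 -> False.
  move=> ltmn ym yn.
  have [_ _ _ _ /(_ _ ym) [_ le1 _]] := gP _ (del0 m).
  have [_ _ _ _ /(_ _ yn) [_ _ lt1]] := gP _ (del0 n).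
  have := delW _ _ ltmn; have := delS m; lra.
move=> m n y ym yn; have [ltmn|ltnm|//] := ltngtP m n.
- by case: (disj m n y).
- by case: (disj n m y).
Qed.

End fan.

(** * The embedding defined by a scheme of balls *)

(* Prefixes are stored reversed, so that the children of a node [s] are the
   nodes [n :: s]. *)
Fixpoint rev_prefix (x : baire_space) (n : nat) : seq nat :=
  if n is m.+1 then x m :: rev_prefix x m else [::].

Lemma size_rev_prefix x n : size (rev_prefix x n) = n.
Proof. by elim: n => //= n ->. Qed.

Lemma rev_prefix_cylinder x y n :
  rev_prefix y n = rev_prefix x n <-> cylinder x n y.
Proof.
elim: n => [|n IH] /=; first by split.
split=> [[yx /IH pre] i|pre].
  by rewrite ltnS leq_eqVlt => /predU1P[->//|/pre].
rewrite (pre n (ltnSn n)) (IH.2 _) // => i lti.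
by apply: pre; exact: leqW.
Qed.

Section scheme.
Variables (P : set Z) (r : nat -> Z) (node : seq nat -> Z * R).
Hypothesis coP : compact (closure P).
Let ball s : set Z := [set y | d (node s).1 y <= (node s).2].
Hypothesis nodeP : forall s, P (node s).1.
Hypothesis node_gt0 : forall s, 0 < (node s).2.
Hypothesis node_le : forall n s, (node (n :: s)).2 <= (size s).+1%:R^-1.
Hypothesis ball_sub : forall n s y, ball (n :: s) y ->
  [/\ y <> r (size s), d (node s).1 y < (node s).2 &
      d (node s).1 y < n.+1%:R^-1].
Hypothesis ball_disj : forall m n s y,
  ball (m :: s) y -> ball (n :: s) y -> m = n.

Lemma ball_prefix_inj x x' n z :
  ball (rev_prefix x n) z -> ball (rev_prefix x' n) z ->
  rev_prefix x n = rev_prefix x' n.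
Proof.
elim: n => //= n IH bx bx'.
have pE : rev_prefix x n = rev_prefix x' n.
  have [_ /ltW bx1 _] := ball_sub _ _ _ bx.
  by have [_ /ltW bx1' _] := ball_sub _ _ _ bx'; exact: IH.
by move: bx'; rewrite -pE => bx'; rewrite (ball_disj _ _ _ _ bx bx').
Qed.

Lemma ball_prefixW x m n z :
  (m <= n)%N -> ball (rev_prefix x n) z -> ball (rev_prefix x m) z.
Proof.
elim: n => [|n IH]; first by rewrite leqn0 => /eqP ->.
rewrite leq_eqVlt => /predU1P[->//|/IH] H bx; apply: H.
by have [_ /ltW] := ball_sub _ _ _ bx.
Qed.

Lemma ball_prefix_dist x n z z' :
  ball (rev_prefix x n.+1) z -> ball (rev_prefix x n.+1) z' ->
  d z z' <= 2 * n.+1%:R^-1.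
Proof.
rewrite /ball /= => bz bz'.
have := node_le (x n) (rev_prefix x n); rewrite size_rev_prefix.
move: (n.+1%:R^-1) => u le_u.
pose q := (node (x n :: rev_prefix x n)).1.
have := dD z q z'; have := dC z q; rewrite /q; lra.
Qed.

(** The centers along the branch have a cluster point by compactness of [closure P]; it lies in
    every ball because the balls are nested and closed. *)
Lemma branch_limit x :
  exists z, closure P z /\ forall n, ball (rev_prefix x n) z.
Proof.
have node_ball m n : (m <= n)%N ->
    ball (rev_prefix x m) (node (rev_prefix x n)).1.
  move=> lemn; apply: (@ball_prefixW x _ _ _ lemn).
  by rewrite /ball /= (d0 _ _).2 // ltW.
pose u n := (node (rev_prefix x n)).1.
have [|z [clz cluz]] := coP (u @ \oo) (fmap_proper_filter _ _).
  apply: (@filterE _ \oo _ (u @^-1` closure P)) => n.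
  by apply: (@subset_closure _ P); exact: nodeP.
exists z; split=> // n; apply: closed_ball_closed => V Vz.
apply: cluz Vz; exists n => // m /= lenm; exact: node_ball.
Qed.

Variable e : baire_space -> Z.
Hypothesis eP : forall x, closure P (e x).
Hypothesis eball : forall x n, ball (rev_prefix x n) (e x).

Lemma limit_uniq x z : (forall n, ball (rev_prefix x n) z) -> e x = z.
Proof.
by move=> bz; apply: dist_le_inv_eq => n; exact: ball_prefix_dist.
Qed.

(** Disjointness of siblings makes a ball determine the prefix; the radii tending to 0 give
    continuity. *)
Lemma limit_embedding : embedding e.
Proof.
split=> [x x' exx'|x A].
  apply/funext => n.
  have : rev_prefix x n.+1 = rev_prefix x' n.+1.
    by apply: (@ball_prefix_inj _ _ _ (e x)) => //; rewrite exx'.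
  by case.
rewrite nbhs_baireP; split=> [[n nA]|[B /dnbhs [eps eps0 epsB] BA]].
  (* [e x] lies in the open ball of its prefix, because the ball of a child stays strictly inside
     that of its parent. *)
  exists [set y | d (node (rev_prefix x n)).1 y < (node (rev_prefix x n)).2].
    by apply: nbhs_open_ball; have [] := ball_sub _ _ _ (eball x n.+1).
  move=> y /= /ltW bey; apply: nA; apply/rev_prefix_cylinder.
  exact: (@ball_prefix_inj _ _ _ (e y)).
have [|n] := @ltr_add_invr R 0 (eps / 2); first by lra.
move=> neps; exists n.+1 => y /rev_prefix_cylinder pE.
apply: BA; apply: epsB => /=.
have : d (e x) (e y) <= 2 * n.+1%:R^-1.
  by apply: ball_prefix_dist (eball x n.+1) _; rewrite -pE.
by move: (n.+1%:R^-1) neps => u; lra.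
Qed.

Lemma limit_avoid x k : e x <> r k.
Proof.
by have [] := ball_sub _ _ _ (eball x k.+1); rewrite size_rev_prefix.
Qed.

(** A point [z] of the closure outside [P] differs from every center. Since the children of a node
    converge to its center, only finitely many come near [z], so [z] is in the closure of the part
    of the range below one child. Iterating gives a branch with limit [z]. *)
Lemma limit_closure : closure (range e) `\` range e `<=` P.
Proof.
move=> z [clz ez]; apply: contrapT => Pz; apply: ez.
pose E s := e @` [set x | rev_prefix x (size s) = s].
have EB s : E s `<=` ball s by move=> _ [x <- <-].
have step s : closure (E s) z -> exists n, closure (E (n :: s)) z.
  move=> clsz; apply: contrapT => /forallNP noz.
  have zs : (node s).1 <> z by move=> zs; apply: Pz; rewrite -zs.
  have zs0 := dist_gt0 zs.
  (* Children with index at least [m] lie within half the distance from the center to [z]; the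
     finitely many others are excluded by [nU]. *)
  have [|m] := @ltr_add_invr R 0 (d (node s).1 z / 2); first by lra.
  rewrite add0r => msz.
  have nV : nbhs z [set y | d z y < d (node s).1 z / 2].
    by apply: dist_nbhs; lra.
  have nU : nbhs z [set y | forall i : 'I_m, ~ E ((i : nat) :: s) y].
    apply: (@filter_forall _ _ (fun i : 'I_m => ~` E ((i : nat) :: s))
      (nbhs z) (nbhs_filter z)) => i.
    have /existsNP [U /not_implyP [Uz UE]] := noz i.
    by apply: filterS Uz => y Uy Ey; apply: UE; exists y.
  have [_ [[x xs <-] [/= exz nE]]] := clsz _ (filterI nV nU).
  have [xm|mx] := ltnP (x (size s)) m.
    by apply: (nE (Ordinal xm)); exists x => //=; rewrite xs.
  have := eball x (size s).+1; rewrite /= xs => /ball_sub [_ _ lt1].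
  have : (x (size s)).+1%:R^-1 <= m.+1%:R^-1 :> R.
    by rewrite lef_pV2 ?posrE ?ltr0Sn // ler_nat.
  move: (_.+1%:R^-1) (m.+1%:R^-1) lt1 msz => u v.
  have := dD (node s).1 (e x) z; have := dC z (e x); lra.
have /choice [g gP] : forall s, exists n,
    closure (E s) z -> closure (E (n :: s)) z.
  move=> s; have [/step [n En]|nE] := pselect (closure (E s) z).
    by exists n.
  by exists 0%N.
pose fix L n := if n is m.+1 then g (L m) :: L m else [::].
have LE n : closure (E (L n)) z.
  elim: n => [|n /gP //] /=.
  by apply: closureS clz => _ [x _ <-]; exists x.
pose x : baire_space := fun n => g (L n).
have xL n : rev_prefix x n = L n by elim: n => //= n ->.
exists x => //; apply: limit_uniq => n; rewrite xL.
apply: closed_ball_closed; apply: closureS (LE n); exact: EB.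
Qed.

End scheme.

Lemma crowded_baire_embedding (P S : set Z) :
  crowded P -> countable S -> compact (closure P) ->
  exists e : baire_space -> Z,
    [/\ embedding e, range e `<=` closure P, range e `&` S = set0 &
        closure (range e) `\` range e `<=` P].
Proof.
move=> crP cS coP; have [[p0 Pp0] _] := crP.
have [r rS] : exists r : nat -> Z, S `<=` range r.
  (* For empty [S] any sequence will do. *)
  have [->|[f]] := pfcard_geP cS; first by exists (fun=> p0).
  by exists f; exact: 'surj_f.
have ieta k : 0 < k.+1%:R^-1 :> R by rewrite invr_gt0 ltr0Sn.
(* [C] maps a ball and its level [k] to the fan of its children, all of which avoid [r k]. *)
have /choice [C CP] : forall t : Z * R * nat, exists c : nat -> Z * R,
    P t.1.1 -> 0 < t.1.2 ->
    (forall n, [/\ P (c n).1, 0 < (c n).2, (c n).2 <= t.2.+1%:R^-1 &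
      forall y, d (c n).1 y <= (c n).2 ->
        [/\ y <> r t.2, d t.1.1 y < t.1.2 & d t.1.1 y < n.+1%:R^-1]]) /\
    forall m n y, d (c m).1 y <= (c m).2 -> d (c n).1 y <= (c n).2 -> m = n.
  move=> [[p eps] k] /=.
  have [Pp|] := pselect (P p); last by exists (fun=> (p, 0)).
  have [eps0|] := ltP 0 eps; last by exists (fun=> (p, 0)).
  have [c cP] := fan P crP p (r k) eps _ Pp eps0 (ieta k).
  by exists c.
pose fix node s := if s is n :: s' then C (node s', size s') n else (p0, 1).
have nodeP s : P (node s).1 /\ 0 < (node s).2.
  elim: s => [|n s [Ps s0]] /=; first by split.
  by have [/(_ n) []] := CP (node s, size s) Ps s0.
have nodeC n s := (CP (node s, size s) (nodeP s).1 (nodeP s).2).1 n.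
have node_le n s : (node (n :: s)).2 <= (size s).+1%:R^-1.
  by have [] := nodeC n s.
have ball_sub n s y : d (node (n :: s)).1 y <= (node (n :: s)).2 ->
    [/\ y <> r (size s), d (node s).1 y < (node s).2 &
        d (node s).1 y < n.+1%:R^-1].
  by have [_ _ _] := nodeC n s; apply.
have ball_disj m n s := (CP (node s, size s) (nodeP s).1 (nodeP s).2).2 m n.
have /choice [e eP] := branch_limit P r node coP
  (fun s => (nodeP s).1) (fun s => (nodeP s).2) ball_sub.
exists e; split.
- exact: (limit_embedding r node node_le ball_sub ball_disj e
    (fun x => (eP x).2)).
- by move=> _ [x _ <-]; have [] := eP x.
- apply/seteqP; split=> // _ [[x _ <-] /rS [k _ rk]].
  exact: (limit_avoid r node ball_sub e (fun x => (eP x).2) x k).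
- exact: (limit_closure P r node (fun s => (nodeP s).1) node_le ball_sub e
    (fun x => (eP x).2)).
Qed.

End metric_facts.

(** * Remainders of closed copies, Miller-null preimages and the intersection *)

Lemma metrizable_separation {R : realType} {Z : topologicalType} :
  metrizable R Z -> hausdorff_space Z /\ regular_space Z.
Proof.
move=> [d [d0 dC dD dnbhs]].
by split; [exact: dist_hausdorff dnbhs|exact: dist_regular dnbhs].
Qed.

(** Since [range f] is closed, a point of [range e] in the closure of [range (e \o f)] is already in
    [range (e \o f)]. *)
Lemma closed_copy_remainder {R : realType} {Z : topologicalType}
    (e : baire_space -> Z) (f : baire_space -> baire_space) :
  metrizable R Z -> embedding e -> compact (closure (range e)) ->
  embedding f -> closed (range f) ->
  [/\ compact (closure (range (e \o f))),
      closure (range (e \o f)) `\` range (e \o f) `<=`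
        closure (range e) `\` range e &
      crowded (closure (range (e \o f)) `\` range (e \o f))].
Proof.
move=> /metrizable_separation [hZ rZ] eemb coe femb clf.
have efe : range (e \o f) `<=` range e by move=> _ [x _ <-]; exists (f x).
have coef : compact (closure (range (e \o f))).
  by apply: subclosed_compact coe _; [exact: closed_closure|exact: closureS].
split=> //; last by apply: crowded_remainder => //; exact: embedding_comp.
move=> z [clz fz]; split; first exact: closureS clz.
move=> [x _ exz]; apply: fz.
suff [y _ yx] : range f x by exists y; rewrite //= yx.
apply: clf; rewrite -(embedding_preimage_closure _ _ eemb) /preimage /= exz.
by rewrite (image_comp f e).
Qed.

(** The Miller property, applied to the remainder of [e \o f], gives a crowded [Q2] with compact
    closure inside [A]. A second ball scheme in [closure Q2], avoiding [Q], factors through [e \o f]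
    and yields the smaller copy. *)
Lemma miller_null_preimage {R : realType} {Z : topologicalType}
    (e : baire_space -> Z) (Q A : set Z) :
  metrizable R Z -> embedding e -> compact (closure (range e)) ->
  countable Q -> range e `&` Q = set0 ->
  closure (range e) `\` range e `<=` Q -> Q `<=` A ->
  miller_property (set_type A) ->
  miller_null (e @^-1` (~` A)).
Proof.
move=> hmet eemb coe cQ eQ0 eQ QA mA N clN /homeomorphic_rangeP [f femb fN].
have [hZ _] := metrizable_separation hmet.
pose ef := e \o f; have efemb : embedding ef by exact: embedding_comp.
have [coef efQ crQ1] : [/\ compact (closure (range ef)),
    closure (range ef) `\` range ef `<=` closure (range e) `\` range e &
    crowded (closure (range ef) `\` range ef)].
  by apply: closed_copy_remainder hmet _ _ _ _ => //; rewrite fN.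
have Q1Q := subset_trans efQ eQ.
have [|||Q2 [Q2Q1 crQ2 coQ2 clQ2]] :=
  (miller_property_subspaceP _ A hZ).1 mA (closure (range ef) `\` range ef).
- exact: subset_trans QA.
- exact: card_le_trans (subset_card_le Q1Q) cQ.
- by [].
have [d [d0 dC dD dnbhs]] := hmet.
have [e' [e'emb e'Q2 e'Q e'cl]] :=
  crowded_baire_embedding d0 dC dD dnbhs Q2 Q crQ2 cQ coQ2.
(* Points of [closure (range ef)] outside [range ef] belong to [Q], which [e'] avoids. *)
have e'ef : range e' `<=` range ef.
  move=> z e'z; apply: contrapT => efz.
  suff : (range e' `&` Q) z by rewrite e'Q.
  split=> //; apply: Q1Q; split=> //.
  by apply: closed_closure; apply: (closureS _ (e'Q2 _ e'z)) => y /Q2Q1 [].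
have [h hemb hE] := embedding_lift _ _ e'emb efemb e'ef.
exists (range (f \o h)); split.
- by rewrite -fN => _ [x _ <-]; exists (h x).
- have efh : e @` range (f \o h) = range e'.
    apply/seteqP; split=> [_ [_ [x _ <-] <-]|_ [x _ <-]].
      by exists x => //; rewrite -hE.
    by exists (f (h x)); [exists x|rewrite -hE].
  move=> x; rewrite -(embedding_preimage_closure _ _ eemb) efh => clx.
  (* Closedness: a limit missed by [e'] would lie in [Q2], hence in [Q], but [e x] is not in [Q]. *)
  have [[y _ e'y]|e'x] := pselect (range e' (e x)).
    by exists y => //; apply: eemb.1; rewrite -e'y -hE.
  suff : (range e `&` Q) (e x) by rewrite eQ0.
  by split; [exists x|apply: Q1Q; apply: Q2Q1; apply: e'cl].
- apply/homeomorphic_rangeP; exists (f \o h) => //; exact: embedding_comp.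
- apply/seteqP; split=> // _ [[x _ <-]]; apply.
  by apply: clQ2; apply: e'Q2; exists x => //; rewrite -hE.
Qed.

(** Otherwise the range of [Y], which is at most as large as [kappa], would be at least as large as
    [F] by minimality. *)
Lemma bigcup_lt_add {T kappa : Type} (I F : set (set T)) (Y : kappa -> set T) :
  is_add I F -> card_lt [set: kappa] F -> (forall a, I (Y a)) ->
  I (\bigcup_a Y a).
Proof.
move=> [_ _ Fmin] [_ Fkappa] IY; apply: contrapT => nI; apply: Fkappa.
apply: card_le_trans (card_image_le Y [set: kappa]).
apply: Fmin; first by move=> _ [a _ <-].
by rewrite bigcup_image.
Qed.

Theorem theorem7p1 (R : realType)
  (add_m0 : set (set baire_space)) (hadd : is_add m0 add_m0)
  (kappa : Type) (kappa_neq0 : [set: kappa] !=set0)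
  (kappa_lt : card_lt [set: kappa] add_m0)
  (Z : topologicalType) (hsep : separable Z) (hmet : metrizable R Z)
  (X : kappa -> set Z)
  (hX : forall a : kappa, miller_property (set_type (X a))) :
  miller_property (set_type (\bigcap_(a in [set: kappa]) X a)).
Proof.
have [hZ _] := metrizable_separation hmet.
apply/miller_property_subspaceP => // Q QX cQ crQ.
have [a0 _] := kappa_neq0.
have [|||Q0 [Q0Q crQ0 coQ0 _]] :=
  (miller_property_subspaceP _ (X a0) hZ).1 (hX a0) Q.
- by move=> z /QX; exact.
- by [].
- by [].
have [d [d0 dC dD dnbhs]] := hmet.
have [e [eemb eQ0 eQ ecl]] :=
  crowded_baire_embedding d0 dC dD dnbhs Q0 Q crQ0 cQ coQ0.
have coe : compact (closure (range e)).
  apply: subclosed_compact coQ0 _; first exact: closed_closure.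
  by apply: subset_trans (closureS eQ0) _; exact: closed_closure.
have eclQ := subset_trans ecl Q0Q.
(* Miller-nullness is applied to the whole Baire space. *)
have /(_ setT) [] : miller_null (\bigcup_a e @^-1` (~` X a)).
- apply: (@bigcup_lt_add _ _ m0 add_m0) => // a.
  apply: (@miller_null_preimage R _ e Q) => //.
  by move=> z /QX; exact.
- exact: closedT.
- apply/homeomorphic_rangeP; exists id; last exact: image_id.
  by split=> // x A; split=> [Ax|[B Bx /filterS]]; [exists A|exact].
move=> N [_ clN /homeomorphic_rangeP [f femb fN] NX].
pose ef := e \o f.
have [coef efQ crQ'] : [/\ compact (closure (range ef)),
    closure (range ef) `\` range ef `<=` closure (range e) `\` range e &
    crowded (closure (range ef) `\` range ef)].
  by apply: closed_copy_remainder hmet _ _ _ _ => //; rewrite fN.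
have Q'Q := subset_trans efQ eclQ.
have clQ' : closure (closure (range ef) `\` range ef) `<=` closure (range ef).
  apply: (subset_trans (@closureS _ _ (closure (range ef)) _)) => [z []//|].
  exact: closed_closure.
exists (closure (range ef) `\` range ef); split=> //.
- by apply: subclosed_compact coef _; first exact: closed_closure.
move=> z /clQ' clz.
(* A point of the closure is either in the remainder, hence in [Q], or of the form [e (f x)] with
   [f x] in [N], which misses every [e @^-1] (~[X a)]. *)
have [[x _ <-]|efz] := pselect (range ef z); last by apply: QX; apply: Q'Q.
move=> a _; apply: contrapT => Xa.
suff : (N `&` \bigcup_a e @^-1` (~` X a)) (f x) by rewrite NX.
by split; [rewrite -fN; exists x|exists a].
Qed.
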